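(* Let $D$ be an oriented twisted link diagram and let $\widetilde D$ be its double covering diagram, which is an oriented virtual link diagram. Then $$\widetilde{Z}_{D}(x,y)=Z_{\widetilde D}(x,y),$$ where $\widetilde Z_D(x,y)=\det(\widetilde M-\widetilde P)$ is computed from the $4n\times4n$ matrices $\widetilde M,\widetilde P$ of $D$ ($n$ the number of real crossings of $D$), and $Z_{\widetilde D}(x,y)=(-1)^{w(\widetilde D)}\det(M-P)$ is computed from the matrices $M,P$ of the virtual link diagram $\widetilde D$.
   Context: **Diagrams.** A virtual link diagram is a generic immersion of finitely many oriented circles in $\mathbb{R}^2$, each double point of which is either a real crossing (with over/under information, hence positive or negative in the usual sense) or a virtual crossing (an encircled double point with no over/under information). A twisted link diagram is a virtual link diagram possibly with finitely many bars; a bar is a short transverse mark on an arc, away from the double points. The writhe $w(D)$ is the number of positive real crossings minus the number of negative real crossings. **Double covering diagram.** Let $D$ be a twisted link diagram with bars $b_1,\dots,b_k$. By planar isotopy assume that $D$ lies to the left of the $y$-axis and that all bars are parallel to the $x$-axis with distinct $y$-coordinates, so that each bar lies on a vertical piece of arc. Let $s(D)$ be the diagram obtained from $D$ by reflection in the $y$-axis (with reflected orientation and bars) followed by switching over and under at all real crossings. Let $l_i$ be the horizontal line containing $b_i$ and $s(b_i)$. In a thin horizontal strip around each $l_i$ modify $D\amalg s(D)$ as follows. Remove the bars $b_i$ and $s(b_i)$. Cut the two arcs carrying them. Rejoin the lower end of the arc of $D$ to the upper end of the arc of $s(D)$, and the lower end of the arc of $s(D)$ to the upper end of the arc of $D$.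 The two new arcs run inside the strip, and they cross each other and all other strands of the strip only in virtual crossings. The resulting barless diagram $\widetilde D$ is the double covering diagram of $D$. Its real crossings are those of $D$ together with those of $s(D)$. **The graph and the labels.** For a virtual or twisted link diagram $D$ with real crossings $c_1,\dots,c_n$, $|D|$ is the 4-valent graph, immersed in the plane, whose vertices are the real crossings and whose edges are the arcs of $D$ joining real crossings; virtual crossings are ignored, and edges may carry bars. Closed components meeting no real crossing contribute nothing to the matrices below, and the determinant of an empty matrix is $1$. Near the vertex $c_i$ there are four short edges. Draw the crossing so that both strands are directed upwards. Then $i_0^-$ and $i_1^-$ are the left and right incoming (bottom) short edges, and $i_0^+$ and $i_1^+$ are the left and right outgoing (top) short edges. **$Z_D$ for a virtual link diagram $D$.** Put $$M_+=\begin{pmatrix}1-x&-y\\-xy^{-1}&0\end{pmatrix},\qquad M_-=\begin{pmatrix}0&-x^{-1}y\\-y^{-1}&1-x^{-1}\end{pmatrix}.$$ Let $M=\mathrm{diag}(M_1,\dots,M_n)$ with $M_i=M_+$ or $M_-$ according to whether $c_i$ is positive or negative. Let $P=(p_{kl})$ be the $2n\times2n$ matrix with, for $i,j\in\{1,\dots,n\}$ and $\epsilon,\lambda\in\{0,1\}$, $p_{(2i-1+\epsilon)(2j-1+\lambda)}=1$ if $i_\epsilon^-$ and $j_\lambda^+$ lie on the same edge of $|D|$, and $0$ otherwise. Then $Z_D(x,y)=(-1)^{w(D)}\det(M-P)$, which does not depend on the numbering of the crossings. **$\widetilde Z_D$ for a twisted link diagram $D$.** Let $\widetilde M_\pm=\mathrm{diag}(M_\pm,M_\pm)$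 and $\widetilde M=\mathrm{diag}(\widetilde M_1,\dots,\widetilde M_n)$ with $\widetilde M_i=\widetilde M_+$ or $\widetilde M_-$ according to whether $c_i$ is positive or negative. For $\epsilon,\lambda\in\{0,1\}$ write $i_\epsilon\overset{\mathrm e}{\leftarrow}j_\lambda$ (resp. $i_\epsilon\overset{\mathrm o}{\leftarrow}j_\lambda$) if $i_\epsilon^-$ and $j_\lambda^+$ lie on the same edge of $|D|$ and that edge carries an even (resp. odd) number of bars. If $k$ or $l$ is in $\{2,3\}$, the relations $i_k\overset{\mathrm e}{\leftarrow}j_l$ and $i_k\overset{\mathrm o}{\leftarrow}j_l$ are declared false. The $4n\times4n$ matrix $\widetilde P=(\tilde p_{kl})$ is given, for $i,j\in\{1,\dots,n\}$ and $a,b\in\{0,1,2,3\}$, by $$\tilde p_{(4i-3+a)(4j-3+b)}=\begin{cases}1&\text{if } i_a\overset{\mathrm e}{\leftarrow}j_b\ \text{or}\ i_{3-a}\overset{\mathrm e}{\leftarrow}j_{3-b}\ \text{or}\ i_a\overset{\mathrm o}{\leftarrow}j_{3-b}\ \text{or}\ i_{3-a}\overset{\mathrm o}{\leftarrow}j_b,\\0&\text{otherwise.}\end{cases}$$ Then $\widetilde Z_D(x,y)=\det(\widetilde M-\widetilde P)$. *)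

(* Defs.v *)
From HB Require Import structures.
From mathcomp Require Import all_boot all_order all_algebra.
From mathcomp Require Import all_classical all_reals all_analysis.
Set Implicit Arguments.
Unset Strict Implicit.
Unset Printing Implicit Defensive.
Import Order.TTheory GRing.Theory Num.Theory.
Import numFieldNormedType.Exports.
Local Open Scope ring_scope.

(** A diagram is an honest family of oriented closed curves in the plane
    [R * R], cut into finitely many arcs.  Each arc is parametrized by [0, 1];
    [path e] is defined on all of [R] only so that derivatives at 0 and 1 make
    sense (every C^1 curve on [0, 1] extends).  Following [next] glues the arcs;
    the cycles of [next] are the components.  How the curves are cut is
    immaterial, except that every bar is carried by an arc of its own: [e] is in
    [bars] when there is exactly one bar on [e].
    [over i] and [under i] are the two passages (arc, parameter) through the
    [i]-th real crossing.  All double points that are not listed as real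
    crossings are virtual crossings. *)
Record diagram (R : realType) := Diagram {
  arc : finType;
  path : arc -> R -> R * R;
  next : arc -> arc;
  ncross : nat;
  over : 'I_ncross -> arc * R;
  under : 'I_ncross -> arc * R;
  bars : {set arc} }.

Section Diagrams.
Variable R : realType.
Implicit Types (D : diagram R) (z u v : R * R) (t : R).

Definition det2 u v : R := u.1 * v.2 - u.2 * v.1.

(** The parameter range is half open, since the end point of an arc [e] is the
    starting point of [next e]. *)
Definition source D (p : arc D * R) : Prop := 0 <= p.2 < 1.
Definition pos D (p : arc D * R) : R * R := path p.1 p.2.
Definition vel D (p : arc D * R) : R * R := derive1 (path p.1) p.2.

Definition double_point D z : Prop := exists p q : arc D * R,
  [/\ source p, source q, p <> q, pos p = z & pos q = z].

(** Generic immersion of oriented circles with over/under information at some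
    of its double points, and bars.  Finiteness of the set of double points
    follows from transversality and compactness. *)
Record twisted_link_diagram D : Prop := {
  next_injective : injective (@next R D);
  path_derivable : forall (e : arc D) t, derivable (path e) t 1;
  path_C1 : forall e : arc D, continuous (derive1 (path e));
  path_regular : forall (e : arc D) t, 0 <= t <= 1 -> derive1 (path e) t <> 0;
  path_joined : forall e : arc D, path e 1 = path (next e) 0;
  path_smooth : forall e : arc D, exists2 c : R, 0 < c &
    derive1 (path e) 1 = c *: derive1 (path (next e)) 0;
  double_transverse : forall p q : arc D * R, source p -> source q ->
    p <> q -> pos p = pos q -> det2 (vel p) (vel q) <> 0;
  no_triple_point : forall p q r : arc D * R,
    source p -> source q -> source r -> p <> q -> p <> r -> q <> r ->
    ~ (pos p = pos q /\ pos q = pos r);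
  over_source : forall i, source (over (d := D) i);
  under_source : forall i, source (under (d := D) i);
  over_neq_under : forall i, over (d := D) i <> under i;
  over_under : forall i, pos (over (d := D) i) = pos (under i);
  crossings_distinct : forall i j,
    pos (over (d := D) i) = pos (over j) -> i = j;
  bars_off_double_points : forall (e : arc D) t,
    e \in bars D -> 0 <= t <= 1 -> ~ double_point D (path e t);
  (* consecutive bars are separated by an unmarked arc *)
  bars_apart : forall e : arc D, e \in bars D -> next e \notin bars D }.

Definition virtual_link_diagram D : Prop :=
  twisted_link_diagram D /\ bars D = finset.set0.

Definition positive D (i : 'I_(ncross D)) : bool :=
  0 < det2 (vel (over i)) (vel (under i)).

Definition writhe D : int :=
  \sum_(i < ncross D) (if positive i then 1 else -1).

(** When both strands at a crossing point upwards, the strand [a] running from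
    bottom left to top right and the other strand [b] satisfy
    [0 < det2 a b].  So [a] is the over strand exactly at a positive crossing;
    it carries the short edges i_0^- and i_1^+, and [b] carries i_1^- and
    i_0^+. *)
Definition in_strand D (i : 'I_(ncross D)) (eps : nat) : arc D * R :=
  if (eps == 0)%N == positive i then over i else under i.
Definition out_strand D (i : 'I_(ncross D)) (eps : nat) : arc D * R :=
  if (eps == 0)%N == positive i then under i else over i.

Definition real_passage D (r : arc D * R) : Prop :=
  exists i, r = over i \/ r = under i.

(** [r] lies strictly between [p] and [q] on the run that starts at [p], goes
    through the arcs [iter 0 next p.1], ..., [iter k next p.1] and stops at
    [q]. *)
Definition on_run D (p q : arc D * R) (k : nat) (r : arc D * R) : Prop :=
  exists j : nat, [/\ (j <= k)%N, r.1 = iter j (@next R D) p.1,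
    (j = 0%N -> p.2 < r.2) & (j = k -> r.2 < q.2)].

(** The run from [p] to [q] is an edge of the graph |D|.  The case [p = q] is
    that of a component with a single passage through real crossings. *)
Definition edge_run D (p q : arc D * R) (k : nat) : Prop :=
  [/\ q.1 = iter k (@next R D) p.1, (k = 0%N -> p.2 < q.2) &
      forall r, on_run p q k r -> ~ real_passage r].

Definition bars_on_run D (p : arc D * R) (k : nat) : nat :=
  (\sum_(j < k.+1) (iter j (@next R D) p.1 \in bars D))%N.

Definition same_edge D (i : 'I_(ncross D)) (eps : nat)
    (j : 'I_(ncross D)) (lam : nat) : Prop :=
  exists k, edge_run (out_strand j lam) (in_strand i eps) k.

(** i_a <-e- j_b for [o = false] and i_a <-o- j_b for [o = true]; false when
    [a] or [b] is 2 or 3. *)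
Definition arrow D (o : bool) (i : 'I_(ncross D)) (a : nat)
    (j : 'I_(ncross D)) (b : nat) : Prop :=
  [/\ (a < 2)%N, (b < 2)%N &
    exists2 k, edge_run (out_strand j b) (in_strand i a) k &
      odd (bars_on_run (out_strand j b) k) = o].

Definition reflect_y z : R * R := (- z.1, z.2).

Definition move (f : R * R -> R * R) D : diagram R :=
  @Diagram R (arc D) (fun e t => f (path e t)) (@next R D) (ncross D)
    (@over R D) (@under R D) (bars D).

(** s(D); the exchange of [over] and [under] keeps the signs. *)
Definition mirror D : diagram R :=
  @Diagram R (arc D) (fun e t => reflect_y (path e t)) (@next R D) (ncross D)
    (@under R D) (@over R D) (bars D).

Definition differential (f : R * R -> R * R) z v : R * R := 'd f z v.

(** The isotopy parameter ranges over [0, 1]; times outside this interval are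
    harmless, as an isotopy can be reparametrized to be constant there. *)
Definition ambient_isotopy (H : R -> R * R -> R * R) : Prop :=
  [/\ (forall z, H 0 z = z),
      (forall t z, differentiable (H t) z),
      continuous (fun w : R * (R * R) => H w.1 w.2),
      (forall v, continuous (fun w : R * (R * R) => differential (H w.1) w.2 v)) &
      forall t, exists G : R * R -> R * R,
        [/\ cancel (H t) G, cancel G (H t) & forall z, differentiable G z]].

Definition planar_isotopic D D' : Prop :=
  exists2 H, ambient_isotopy H & D' = move (H 1) D.

(** For a vertical arc [e]: the horizontal strip spanned by [e]. *)
Definition in_strip D (e : arc D) z : Prop :=
  Num.min (path e 0).2 (path e 1).2 <= z.2 <=
  Num.max (path e 0).2 (path e 1).2.

(** The bars are parallel to the x-axis, on vertical arcs, each in its own thin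
    strip free of real crossings. *)
Record normal_position D : Prop := {
  left_of_axis : forall (e : arc D) t, 0 <= t <= 1 -> (path e t).1 < 0;
  bars_vertical : forall (e : arc D) t, e \in bars D -> 0 <= t <= 1 ->
    (path e t).1 = (path e 0).1;
  strips_disjoint : forall e f : arc D, e \in bars D -> f \in bars D ->
    e <> f -> forall z, ~ (in_strip e z /\ in_strip f z);
  strips_thin : forall (e : arc D) i, e \in bars D ->
    ~ in_strip e (pos (over (d := D) i)) }.

(** [new e false] starts where the barred arc [e] of D starts and ends where its
    mirror image ends; [new e true] does the opposite.  For either orientation
    of [e] this joins the lower end in D to the upper end in s(D) and the lower
    end in s(D) to the upper end in D. *)
Definition rejoining_arcs D (new : arc D -> bool -> R -> R * R) : Prop :=
  forall e : arc D, e \in bars D ->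
    [/\ new e false 0 = path e 0,
        new e false 1 = reflect_y (path e 1),
        new e true 0 = reflect_y (path e 0),
        new e true 1 = path e 1 &
        forall b t, 0 <= t <= 1 -> in_strip e (new e b t)].

(** D and s(D) ([false] and [true] copies) with the barred arcs replaced by
    [new].  The real crossings are those of D, followed by those of s(D). *)
Definition splice D (new : arc D -> bool -> R -> R * R) : diagram R :=
  @Diagram R (arc D * bool)%type
    (fun eb => if eb.1 \in bars D then new eb.1 eb.2
               else if eb.2 then @path R (mirror D) eb.1 else path eb.1)
    (fun eb => (next eb.1, eb.2 (+) (eb.1 \in bars D)))
    (ncross D + ncross D)
    (fun i => match fintype.split i with
              | inl j => let p := over j in ((p.1, false), p.2)
              | inr j => let p := @over R (mirror D) j in ((p.1, true), p.2)
              end)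
    (fun i => match fintype.split i with
              | inl j => let p := under j in ((p.1, false), p.2)
              | inr j => let p := @under R (mirror D) j in ((p.1, true), p.2)
              end)
    finset.set0.

(** The result is required to be generic: the new arcs meet each other and the
    other strands only transversally, away from other double points.  These
    intersections are virtual as they are not listed as real crossings. *)
Definition double_covering_diagram D Dt : Prop :=
  exists (D' : diagram R) (new : arc D' -> bool -> R -> R * R),
    [/\ planar_isotopic D D', normal_position D', rejoining_arcs new,
        Dt = splice new & virtual_link_diagram Dt].

Variable A : comUnitRingType.
Implicit Types x y : A.

Definition mx22 (a b c d : A) : 'M[A]_2 :=
  block_mx (a%:M : 'M[A]_1) (b%:M : 'M[A]_1) (c%:M : 'M[A]_1) (d%:M : 'M[A]_1).

Definition Mpos x y : 'M[A]_2 := mx22 (1 - x) (- y) (- (x * y^-1)) 0.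
Definition Mneg x y : 'M[A]_2 := mx22 0 (- (x^-1 * y)) (- y^-1) (1 - x^-1).

Definition Mcross D x y (i : 'I_(ncross D)) : 'M[A]_2 :=
  if positive i then Mpos x y else Mneg x y.

Definition Pblock D (i j : 'I_(ncross D)) : 'M[A]_2 :=
  \matrix_(eps < 2, lam < 2) (`[< same_edge i eps j lam >])%:R.

Definition Zinv D x y : A :=
  (-1) ^ writhe D *
  \det (\mxdiag_(i < ncross D) Mcross x y i -
        \mxblock_(i < ncross D, j < ncross D) Pblock i j).

Definition tMcross D x y (i : 'I_(ncross D)) : 'M[A]_4 :=
  block_mx (Mcross x y i) 0 0 (Mcross x y i) : 'M[A]_(2 + 2).

Definition tPblock D (i j : 'I_(ncross D)) : 'M[A]_4 :=
  \matrix_(a < 4, b < 4)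
    (`[< arrow false i a j b \/ arrow false i (3 - a)%N j (3 - b)%N \/
         arrow true i a j (3 - b)%N \/ arrow true i (3 - a)%N j b >])%:R.

Definition tZinv D x y : A :=
  \det (\mxdiag_(i < ncross D) tMcross x y i -
        \mxblock_(i < ncross D, j < ncross D) tPblock i j).

End Diagrams.

(* Main.v *)
From HB Require Import structures.
Require Import Defs.
From mathcomp Require Import all_boot all_order all_algebra.
From mathcomp Require Import all_classical all_reals all_analysis.
From mathcomp Require Import perm ring.
Local Open Scope ring_scope.
Set Implicit Arguments.
Unset Strict Implicit.
Unset Printing Implicit Defensive.
Import Order.TTheory GRing.Theory Num.Theory.
Import numFieldNormedType.Exports.
Import Defs.

(** A planar isotopy has a Jacobian that starts at 1 and never vanishes, so it
    keeps the signs of the crossings, and [tZinv] depends on nothing else that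
    the isotopy moves.  Reflecting a crossing and exchanging its two strands
    keeps its sign but exchanges the labels 0 and 1.  A run in the double
    covering diagram is the lift of a run in [D], and it changes sheet exactly
    when that run carries an odd number of bars.  So label [a < 2] of the i-th
    block of the 4n x 4n matrix is label [a] at the copy of the i-th crossing in
    [D], label [a >= 2] is label [a - 2] at its copy in the mirror image, and
    the two matrices agree up to a simultaneous permutation of rows and columns.
    The signs of the crossings being doubled, the writhe is even. *)

(** * Determinants of block matrices and reindexing *)

Section Determinants.
Variable A : comUnitRingType.

(** The bijection forces [N = M]. Rows and columns then undergo the same permutation, so its sign
    enters twice and cancels. *)
Lemma det_mxsub_bij (N M : nat) (h : 'I_N -> 'I_M) (B : 'M[A]_M) :
  bijective h -> \det (mxsub h h B) = \det B.
Proof.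
move=> bij_h; have := bij_eq_card bij_h; rewrite !card_ord => eqNM.
case: M / eqNM h B bij_h => h B bij_h.
pose s := perm (bij_inj bij_h).
have -> : mxsub h h B = row_perm s (col_perm s B).
  by apply/matrixP => i j; rewrite !mxE !permE.
rewrite row_permE col_permE !det_mulmx !det_perm odd_permV.
by rewrite mulrC -mulrA -signr_addb addbb mulr1.
Qed.

(** The two matrices to be compared have sizes that are equal but not convertible. Indexing both by
    a common [T] avoids casts. *)
Lemma det_reindex (T : finType) (N M : nat) (f : T -> 'I_N) (g : T -> 'I_M)
    (B : 'M[A]_N) (C : 'M[A]_M) :
  bijective f -> bijective g ->
  (forall s t, B (f s) (f t) = C (g s) (g t)) -> \det B = \det C.
Proof.
move=> [f' fK f'K] bij_g eqBC.
rewrite -(@det_mxsub_bij _ _ (g \o f') C); last first.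
  by apply: bij_comp => //; exists f.
by congr (\det _); apply/matrixP => i j; rewrite !mxE /= -eqBC !f'K.
Qed.

Definition block_index (n c : nat) (i : 'I_n) (a : 'I_c) :
  'I_(\sum_(i < n) c) := @tagnat.Rank n (fun=> c) i a.

Lemma block_index_inj n c (i j : 'I_n) (a b : 'I_c) :
  block_index i a = block_index j b -> i = j /\ a = b.
Proof.
rewrite /block_index => eq_ij.
have eqij : i = j.
  have := congr1 (@tagnat.sig1 n (fun=> c)) eq_ij.
  by rewrite !tagnat.Rank1K.
split=> //; apply: val_inj; subst j.
have /eqP := congr1 val eq_ij; rewrite tagnat.eq_Rank => /andP [_ /eqP]; done.
Qed.

Lemma mxblock_index n c (B : forall i j : 'I_n, 'M[A]_c) i j a b :
  (\mxblock_(i < n, j < n) B i j) (block_index i a) (block_index j b) =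
  B i j a b.
Proof.
have := @mxblockK _ n n (fun=> c) (fun=> c) B i j.
by move=> /matrixP /(_ a b); rewrite !mxE.
Qed.

Lemma mxdiag_index n c (B : forall i : 'I_n, 'M[A]_c) i j a b :
  (\mxdiag_(i < n) B i) (block_index i a) (block_index j b) =
  (if i == j then B i else 0) a b.
Proof.
(* [mxdiag] casts its blocks by [conform_mx], which is the identity when all sizes are [c]. *)
by rewrite /mxdiag mxblock_index; case: ifP => // _; rewrite conform_mx_id.
Qed.

End Determinants.


(** * Planar maps and the orientation of pairs of tangent vectors *)

Section PlanarMaps.
Variable R : realType.
Implicit Types (D : diagram R) (z u v : R * R) (H : R -> R * R -> R * R).

Definition jacobian (f : R * R -> R * R) z : R :=
  det2 (differential f z (1, 0)) (differential f z (0, 1)).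

Lemma det2_linear (L : {linear (R * R)%type -> (R * R)%type}) u v :
  det2 (L u) (L v) = det2 (L (1, 0)) (L (0, 1)) * det2 u v.
Proof.
have expand w : L w = w.1 *: L (1, 0) + w.2 *: L (0, 1).
  rewrite -!linearZ -linearD; congr (L _); case: w => a b /=.
  by congr (_, _) => /=; rewrite /GRing.scale /= !mulr0 !mulr1 ?addr0 ?add0r.
rewrite (expand u) (expand v) /det2 /GRing.scale /=.
by case: (L (1, 0)) (L (0, 1)) => a b [c d]; rewrite /GRing.scale /=; ring.
Qed.

Lemma det2_differential (f : R * R -> R * R) z u v :
  det2 (differential f z u) (differential f z v) = jacobian f z * det2 u v.
Proof. exact: det2_linear. Qed.

Lemma differential_id z v : differential id z v = v.
Proof. by rewrite /differential diff_val. Qed.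

(** By the chain rule the differential of [g] undoes that of [f], so the two Jacobians multiply to
    1. *)
Lemma jacobian_neq0 (f g : R * R -> R * R) z :
  cancel f g -> differentiable f z -> differentiable g (f z) ->
  jacobian f z != 0.
Proof.
move=> fK df dg; apply/eqP => J0.
have E : 'd (g \o f) z = 'd g (f z) \o 'd f z :> (R * R -> R * R).
  exact: diff_comp.
have gf : g \o f = id by apply/funext => w /=; rewrite fK.
have K w : differential g (f z) (differential f z w) = w.
  have := congr1 (fun k => k w) E.
  by rewrite gf -/(differential id z w) differential_id.
have := det2_differential g (f z)
  (differential f z (1, 0)) (differential f z (0, 1)).
rewrite !K -/(jacobian f z) J0 mulr0 /det2 /= mulr1 mul0r subr0.
by move/eqP; rewrite oner_eq0.
Qed.

Lemma isotopy_jacobian_gt0 H z t : ambient_isotopy H -> 0 <= t ->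
  0 < jacobian (H t) z.
Proof.
move=> [H0 dH _ cdH invH] t0.
have J0 : jacobian (H 0) z = 1.
  have -> : H 0 = id by apply/funext.
  by rewrite /jacobian !differential_id /det2 /= mulr1 mul0r subr0.
have Jneq0 s : jacobian (H s) z != 0.
  by have [G [HK _ dG]] := invH s; exact: (jacobian_neq0 HK).
have cJ : continuous (fun s => jacobian (H s) z).
  have cd v : continuous (fun s => differential (H s) z v).
    move=> s; apply: (@cvg_comp _ _ _ (fun s => (s, z)) (fun w : R * (R * R) =>
      differential (H w.1) w.2 v) _ _ _ _ (cdH v (s, z))).
    apply: (@cvg_pair _ _ _ (nbhs s) (nbhs s) (nbhs z) _ _ _ idfun (fun=> z)).
      exact: cvg_id.
    exact: cvg_cst.
  have c1 v : continuous (fun s => (differential (H s) z v).1).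
    by move=> s; apply: (continuous_comp (g := fst) (cd v s)); exact: cvg_fst.
  have c2 v : continuous (fun s => (differential (H s) z v).2).
    by move=> s; apply: (continuous_comp (g := snd) (cd v s)); exact: cvg_snd.
  move=> s; apply: cvgB; apply: cvgM;
    by [exact: c1 | exact: c2 | exact: c2 | exact: c1].
rewrite lt_neqAle eq_sym Jneq0 /= leNgt; apply/negP => Jt.
(* The first [0] is the initial time, the second the value sought: a negative Jacobian at time [t]
   would force a zero in between. *)
have [] := @IVT R (fun s => jacobian (H s) z) 0 t 0 t0.
- by apply: continuous_subspaceT.
- by rewrite J0 ge_min le_max ler01 (ltW Jt) orbT.
by move=> c _ /eqP; rewrite (negbTE (Jneq0 c)).
Qed.

Lemma derive1_comp_plane (f : R * R -> R * R) (g : R -> R * R) t :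
  derivable g t 1 -> differentiable f (g t) ->
  derive1 (fun s => f (g s)) t = differential f (g t) (derive1 g t).
Proof.
move=> /derivable1_diffP dg df.
rewrite (derive1E' dg) (derive1E' (differentiable_comp dg df)).
have E := diff_comp dg df.
by have := congr1 (fun k => k 1) E.
Qed.

Lemma positive_isotopy D H i : twisted_link_diagram D -> ambient_isotopy H ->
  positive (D := move (H 1) D) i = positive (D := D) i.
Proof.
move=> tD isoH; have [_ dH _ _ _] := isoH.
rewrite /positive /vel /= !derive1_comp_plane //; [|exact: path_derivable..].
(* Both velocities are now pushed forward by the differential at one and the same point. *)
have -> : path (@under R D i).1 (@under R D i).2 =
    path (@over R D i).1 (@over R D i).2.
  by have := over_under tD i.
by rewrite det2_differential pmulr_rgt0 // isotopy_jacobian_gt0.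
Qed.

Lemma linear_reflect_y : linear (@reflect_y R : (R * R)%type -> (R * R)%type).
Proof.
move=> k u v; rewrite /reflect_y; congr (_, _) => /=.
by rewrite opprD -scalerN.
Qed.

(** The reversal of orientation is written as a swap of arguments, to match the exchange of strands
    in [mirror]. *)
Lemma det2_reflect_y u v : det2 (reflect_y u) (reflect_y v) = det2 v u.
Proof. by rewrite /det2 /=; ring. Qed.

HB.instance Definition _ :=
  GRing.isLinear.Build R (R * R)%type (R * R)%type *:%R (@reflect_y R)
    linear_reflect_y.

Lemma continuous_reflect_y : continuous (@reflect_y R).
Proof.
move=> z; apply: (@cvg_pair _ _ _ (nbhs z) (nbhs (- z.1)) (nbhs z.2) _ _ _
  (fun w => - w.1) snd); last exact: cvg_snd.
by apply: (@cvgN _ _ _ _ _ fst); exact: cvg_fst.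
Qed.

Lemma derive1_reflect_y (g : R -> R * R) t : derivable g t 1 ->
  derive1 (fun s => reflect_y (g s)) t = reflect_y (derive1 g t).
Proof.
move=> dg; rewrite derive1_comp_plane // /differential.
  by rewrite diff_lin //; exact: continuous_reflect_y.
by apply: linear_differentiable; exact: continuous_reflect_y.
Qed.

End PlanarMaps.

(** * The labelled graph of a moved diagram *)

Section Graphs.
Variable R : realType.
Implicit Types D : diagram R.

(** Arcs, [next], passages and bars of [move f D] are those of [D] by conversion; the curves enter
    [tZinv] only through the signs. *)
Lemma tZinv_move (A : comUnitRingType) (x y : A) D f :
  (forall i, positive (D := move f D) i = positive (D := D) i) ->
  tZinv (move f D) x y = tZinv D x y.
Proof.
move=> eq_pos.
have eqM : \mxdiag_(i < ncross D) tMcross (D := move f D) x y i =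
    \mxdiag_(i < ncross D) tMcross (D := D) x y i.
  by apply: eq_mxdiag => i; rewrite /tMcross /Mcross eq_pos.
have eq_arrow : @arrow R (move f D) = @arrow R D.
  apply/funext => o; apply/funext => i; apply/funext => a; apply/funext => j.
  apply/funext => b.
  by rewrite /arrow /edge_run /out_strand /in_strand !eq_pos.
(* [tPblock] with its relation abstracted, so that [eq_arrow] can be applied by congruence. *)
pose block (ar : bool -> 'I_(ncross D) -> nat -> 'I_(ncross D) -> nat -> Prop)
    i j : 'M[A]_4 := \matrix_(a < 4, b < 4)
  (`[< ar false i a j b \/ ar false i (3 - a)%N j (3 - b)%N \/
       ar true i a j (3 - b)%N \/ ar true i (3 - a)%N j b >])%:R.
have eqP : \mxblock_(i < ncross D, j < ncross D) tPblock A (D := move f D) i j =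
    \mxblock_(i < ncross D, j < ncross D) tPblock A (D := D) i j.
  exact: (congr1 (fun ar => \mxblock_(i < ncross D, j < ncross D) block ar i j)
    eq_arrow).
exact: (congr2 (fun M P => \det (M - P)) eqM eqP).
Qed.

(** * Lifting crossings, runs and labels to the two sheets *)

Section Splice.
Variables (D : diagram R) (new : arc D -> bool -> R -> R * R).
Hypothesis over_unbarred : forall i, (@over R D i).1 \notin bars D.
Hypothesis under_unbarred : forall i, (@under R D i).1 \notin bars D.
Hypothesis D_derivable : forall (e : arc D) t, derivable (path e) t 1.
Local Notation Dt := (splice new).
Local Notation n := (ncross D).

Definition lift_crossing (c : bool) (i : 'I_n) : 'I_(ncross Dt) :=
  if c then rshift n i else lshift n i.

Definition lift_passage (c : bool) (p : arc D * R) : arc Dt * R :=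
  ((p.1, c), p.2).

Lemma lift_crossing_inj c d i j :
  lift_crossing c i = lift_crossing d j -> c = d /\ i = j.
Proof.
case: c d => [] []; rewrite /lift_crossing => /eqP;
  rewrite ?eq_rlshift ?eq_lrshift ?eq_rshift ?eq_lshift //= => /eqP; done.
Qed.

Lemma lift_crossing_surj (i : 'I_(ncross Dt)) :
  exists c j, i = lift_crossing c j.
Proof.
by case: (split_ordP i) => j ->; [exists false, j | exists true, j].
Qed.

Lemma over_lift c i : over (lift_crossing c i) =
  lift_passage c (if c then under i else over i).
Proof.
by case: c; rewrite /= ?(unsplitK (inl i)) ?(unsplitK (inr i)).
Qed.

Lemma under_lift c i : under (lift_crossing c i) =
  lift_passage c (if c then over i else under i).
Proof.
by case: c; rewrite /= ?(unsplitK (inl i)) ?(unsplitK (inr i)).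
Qed.

Lemma real_passage_lift c p :
  real_passage (lift_passage c p) <-> real_passage p.
Proof.
have lift_inj d q : lift_passage c p = lift_passage d q -> p = q.
  by case: p q => [e t] [e' t'] [-> _ ->].
split=> [[i]|[i]].
  have [d [j ->]] := lift_crossing_surj i.
  rewrite over_lift under_lift.
  by case=> /lift_inj ->; exists j; case: d; [right|left|left|right].
move=> real_p; exists (lift_crossing c i); rewrite over_lift under_lift.
by case: real_p => ->; clear lift_inj; case: c; [right|left|left|right].
Qed.

Lemma vel_lift c p : p.1 \notin bars D ->
  vel (lift_passage c p) = if c then reflect_y (vel p) else vel p.
Proof.
move=> pN; rewrite /vel /= (negbTE pN); case: c => //=.
exact: derive1_reflect_y.
Qed.

(** On the mirror sheet the reflection and the exchange of strands each reverse the sign. *)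
Lemma positive_lift c i : positive (lift_crossing c i) = positive i.
Proof.
rewrite /positive over_lift under_lift; case: c; rewrite !vel_lift //.
by rewrite det2_reflect_y.
Qed.

Lemma writhe_splice : writhe Dt = writhe D + writhe D.
Proof.
pose sign (b : bool) : int := if b then 1 else -1.
have split_sum := @big_split_ord int 0 +%R n n xpredT
  (fun i : 'I_(n + n) => sign (positive (D := Dt) i)).
apply: (etrans split_sum).
apply: congr2; apply: eq_bigr => i _; apply: (congr1 sign).
  exact: (positive_lift false i).
exact: (positive_lift true i).
Qed.

(** The label in [D] of the strand below label [e] on sheet [c]. In the mirror image over and under
    are exchanged but the sign is kept, so 0 and 1 swap. *)
Definition label (c : bool) (e : nat) : nat := if c then (1 - e)%N else e.

Lemma in_strand_lift c i e : (e < 2)%N ->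
  in_strand (lift_crossing c i) e = lift_passage c (in_strand i (label c e)).
Proof.
rewrite /in_strand positive_lift over_lift under_lift.
by case: e c (positive i) => [|[|//]] [] [].
Qed.

Lemma out_strand_lift c i e : (e < 2)%N ->
  out_strand (lift_crossing c i) e = lift_passage c (out_strand i (label c e)).
Proof.
rewrite /out_strand positive_lift over_lift under_lift.
by case: e c (positive i) => [|[|//]] [] [].
Qed.

Lemma iter_next_splice (e : arc D) c k : iter k (@next R Dt) (e, c) =
  (iter k (@next R D) e,
   c (+) odd (\sum_(j < k) (iter j (@next R D) e \in bars D))%N).
Proof.
elim: k => [|k IHk]; first by rewrite big_ord0 addbF.
by rewrite iterS IHk big_ord_recr /= oddD addbA oddb.
Qed.

(** [bars_on_run] includes the last arc of the run, while the sheet there depends only on the arcs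
    already left. The last arc being unbarred, the parities agree. *)
Lemma odd_bars_on_run (p q : arc D * R) k : q.1 \notin bars D ->
  q.1 = iter k (@next R D) p.1 ->
  odd (bars_on_run p k) =
  odd (\sum_(j < k) (iter j (@next R D) p.1 \in bars D))%N.
Proof.
move=> qN eq_q; rewrite /bars_on_run big_ord_recr /= -eq_q (negbTE qN).
by rewrite addn0.
Qed.

Lemma edge_run_lift c d (p q : arc D * R) k : q.1 \notin bars D ->
  edge_run (lift_passage c p) (lift_passage d q) k <->
  edge_run p q k /\ odd (bars_on_run p k) = c (+) d.
Proof.
move=> qN; rewrite /edge_run iter_next_splice /=; split.
  case=> [[eq_q eq_d]] ltpq free; split.
    split=> // r [j [lejk eq_r ltpr ltrq]] real_r.
    (* The sheet on which the lifted run stands when it passes over [r]. *)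
    pose b := c (+) odd (\sum_(m < j) (iter m (@next R D) p.1 \in bars D))%N.
    apply: (free (lift_passage b r)); last by apply/real_passage_lift.
    by exists j; split=> //=; rewrite iter_next_splice eq_r.
  by rewrite (odd_bars_on_run qN eq_q) eq_d addKb.
case=> [[eq_q ltpq free]]; rewrite (odd_bars_on_run qN eq_q) => ->.
split=> // [|[[e b] t]]; first by rewrite addKb eq_q.
case=> j [lejk]; rewrite iter_next_splice /= => -[eq_e eq_b] ltpr ltrq.
move=> /(real_passage_lift b (e, t)); apply: free.
by exists j.
Qed.

Lemma same_edge_lift c d i j e f : (e < 2)%N -> (f < 2)%N ->
  same_edge (lift_crossing c i) e (lift_crossing d j) f <->
  arrow (c (+) d) i (label c e) j (label d f).
Proof.
move=> lte ltf; rewrite /same_edge /arrow in_strand_lift // out_strand_lift //.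
have inN : (in_strand i (label c e)).1 \notin bars D.
  by rewrite /in_strand; case: ifP.
have lt_label b m : (m < 2)%N -> (label b m < 2)%N by case: b m => [] [|[]].
split=> [[k /(edge_run_lift _ _ _ _ inN) [run_k odd_k]]|[_ _ [k run_k odd_k]]].
  by split; [exact: lt_label..|exists k => //; rewrite odd_k addbC].
by exists k; apply/(edge_run_lift _ _ _ _ inN); rewrite odd_k addbC.
Qed.

Definition lift_label (c : bool) (e : 'I_2) : 'I_4 :=
  if c then @rshift 2 2 e else @lshift 2 2 e.

Lemma lift_label_inj c d e f :
  lift_label c e = lift_label d f -> c = d /\ e = f.
Proof.
by case: c d e f => [] [] [[|[|//]] ?] [[|[|//]] ?] /(congr1 val) //= _;
  split=> //; apply: val_inj.
Qed.

(** Label [e] of the mirror sheet has index [2 + e], and [3 - (2 + e) = 1 - e] is its label in [D].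
    For each pair of sheets exactly one of the four arrows has both labels below 2; it is the one
    given by [same_edge_lift]. *)
Lemma tPblock_lift (A : comUnitRingType) c d i j e f :
  tPblock A i j (lift_label c e) (lift_label d f) =
  Pblock A (lift_crossing c i) (lift_crossing d j) e f.
Proof.
rewrite !mxE; congr (_%:R); congr nat_of_bool; apply: asbool_equiv_eq.
rewrite same_edge_lift //.
have no_arrow o k a l b : arrow (D := D) o k a l b -> (a < 2)%N && (b < 2)%N.
  by case=> -> ->.
case: e f => [[|[|//]] ?] [[|[|//]] ?]; case: c d => [] [] /=;
  rewrite /label /=; split;
  do ?[by case=> [/no_arrow|[/no_arrow|[/no_arrow|/no_arrow]]]
  | by move=> ?; do ?[left|right]|tauto].
all: by case=> [|[|[|]]] // /no_arrow.
Qed.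

(** No [label] intervenes: rows and columns refer to the labels of the copy itself, and both copies
    have the same sign. *)
Lemma tMcross_lift (A : comUnitRingType) (x y : A) c d i e f :
  tMcross x y i (lift_label c e) (lift_label d f) =
  (if c == d then Mcross x y (lift_crossing c i) else 0) e f.
Proof.
rewrite /tMcross /Mcross positive_lift; case: c d => [] [] /=.
- exact: block_mxEdr.
- by apply: etrans (block_mxEdl _ _ _ _ _ _) _; rewrite !mxE.
- by apply: etrans (block_mxEur _ _ _ _ _ _) _; rewrite !mxE.
- exact: block_mxEul.
Qed.

Lemma tZinv_splice (A : comUnitRingType) (x y : A) : tZinv D x y = Zinv Dt x y.
Proof.
have sign1 : (-1) ^ writhe Dt = 1 :> A.
  rewrite writhe_splice exprzDr ?unitrN1 // -exprMz_comm ?unitrN1 //.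
  by rewrite mulrNN mulr1 exp1rz.
rewrite /Zinv sign1 mul1r /tZinv.
(* [f] orders the triples by crossing, sheet, label, and [g] by sheet, crossing, label. *)
pose f (s : 'I_n * bool * 'I_2) := block_index s.1.1 (lift_label s.1.2 s.2).
pose g (s : 'I_n * bool * 'I_2) := block_index (lift_crossing s.1.2 s.1.1) s.2.
have bij_f : bijective f.
  apply: inj_card_bij.
    move=> [[i c] e] [[j d] e'] /block_index_inj [/= ->].
    by case/lift_label_inj=> -> ->.
  by rewrite !card_prod !card_ord card_bool sum_nat_const card_ord -mulnA.
have bij_g : bijective g.
  apply: inj_card_bij.
    move=> [[i c] e] [[j d] e'] /block_index_inj [].
    by case/lift_crossing_inj => /= -> -> ->.
  rewrite !card_prod !card_ord card_bool sum_nat_const card_ord /= addnn -muln2.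
  by rewrite -mulnA.
apply: (det_reindex bij_f bij_g) => -[[i c] e] [[j d] e'].
rewrite [LHS]mxE [RHS]mxE; congr (_ + _); last first.
  by rewrite [LHS]mxE [RHS]mxE !mxblock_index tPblock_lift.
rewrite !mxdiag_index /=.
case: eqVneq => [<-|neq_ij].
  rewrite tMcross_lift; congr (fun_of_matrix _ e e').
  have [<-|neq_cd] := eqVneq c d; first by rewrite eqxx.
  by case: eqVneq => // /lift_crossing_inj [] /eqP; rewrite (negbTE neq_cd).
rewrite mxE; case: eqVneq => [|_]; last by rewrite mxE.
by case/lift_crossing_inj => _ /eqP; rewrite (negbTE neq_ij).
Qed.
End Splice.
End Graphs.

Theorem theorem4 (R : realType) (A : comUnitRingType) (x y : A)
  (hx : x \is a GRing.unit) (hy : y \is a GRing.unit)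
  (D Dt : diagram R) (hD : twisted_link_diagram D)
  (hDt : double_covering_diagram D Dt) :
  tZinv D x y = Zinv Dt x y.
Proof.
have double i : double_point D (pos (@over R D i)).
  exists (over i), (under i); split=> //; last by rewrite (over_under hD).
  - exact: over_source hD i.
  - exact: under_source hD i.
  - exact: over_neq_under hD i.
(* A barred arc contains no double point, so no passage through a real crossing lies on it. *)
have unbarred (p : arc D * R) :
    source p -> double_point D (pos p) -> p.1 \notin bars D.
  move=> /andP [p0 p1] dp; apply/negP => pb.
  by apply: (bars_off_double_points hD pb _ dp); rewrite p0 ltW.
have [D' [new [[H isoH eqD'] _ _ -> _]]] := hDt; subst D'.
rewrite -(tZinv_move x y (f := H 1)) => [|i]; last exact: positive_isotopy.
(* The isotopy keeps passages and bars, so the first two conditions can be checked in [D]. *)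
apply: tZinv_splice => [i|i|e t].
- by apply: unbarred; [exact: over_source hD i | exact: double].
- apply: unbarred; first exact: under_source hD i.
  by rewrite -(over_under hD); exact: double.
have [_ dH _ _ _] := isoH; apply/derivable1_diffP.
have /derivable1_diffP dp := @path_derivable _ _ hD e t.
exact: (differentiable_comp dp (dH 1 _)).
Qed.
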